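(* Let $\alpha,\beta\in\mathbb{C}$ with $\mathrm{Re}(\beta)>-1$, and let $n\ge 1$ be an integer such that none of the numbers $\alpha k+\beta+1$ ($0\le k\le n$) is a non-positive integer (this is automatic if $\alpha$ is a positive integer). Then for all $z\in\mathbb{C}$, $$ L_n^{(\alpha,\beta)}(z)=\sum_{k=1}^n(-1)^{n-k}\sum_{\substack{t_1+\cdots+t_k=n\\ t_1,\dots,t_k\ge 1}}a_0^{(t_1)}\,a_{t_1}^{(t_2)}\,a_{t_1+t_2}^{(t_3)}\cdots a_{t_1+\cdots+t_{k-1}}^{(t_k)}, $$ where the inner sum is over all $k$-tuples of positive integers $(t_1,\dots,t_k)$ with sum $n$, and $$ a_j^{(\ell)}=B_{\ell+j,\ell}-\frac{z}{j+1}\,\delta_{\ell,1}\qquad(1\le\ell\le n-j;\ j=0,1,\dots,n-1), $$ with $\delta_{\ell,1}=1$ if $\ell=1$ and $\delta_{\ell,1}=0$ if $\ell\ne 1$.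
   Context: For an integer $n\ge 0$, the polynomial $L_n^{(\alpha,\beta)}(z)$ (the case $q=1$ of the generalized Laguerre polynomials $L_{\lfloor n/q\rfloor}^{(\alpha,\beta)}(z)$) is $$ L_n^{(\alpha,\beta)}(z)=\frac{\Gamma(\alpha n+\beta+1)}{\Gamma(n+1)}\sum_{k=0}^{n}\frac{(-n)^{(k)}}{\Gamma(\alpha k+\beta+1)}\frac{z^k}{k!}, $$ where $(\gamma)^{(k)}=\gamma(\gamma+1)\cdots(\gamma+k-1)$ is the rising factorial (with $(\gamma)^{(0)}=1$). In particular $L_0^{(\alpha,\beta)}(z)=1$. The falling factorial is $(\gamma)_s:=\Gamma(\gamma+1)/\Gamma(\gamma-s+1)$, used here also for the indices $s=\alpha$ and $s=(m-1)\alpha$ by this Gamma-function formula, with the convention that $1/\Gamma$ takes the value $0$ at the poles of $\Gamma$. For integers $n\ge m\ge 1$ put $$ C_{n,m}=C_{n,m}(\alpha,\beta):=\frac{1}{m!\,n}\sum_{j=0}^m(-1)^j\binom{m}{j}(n-j)\bigl(\alpha(n-j)+\beta\bigr)_{\alpha}, \qquad B_{n,m}:=\bigl(\alpha(n-1)+\beta\bigr)_{(m-1)\alpha}\,C_{n,m}. $$ *)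

(* Defs.v *)
(* The complex numbers are R[i] for R : realType. *)
From HB Require Import structures.
From mathcomp Require Import all_boot all_order all_algebra.
From mathcomp Require Import all_classical all_reals all_analysis.
From mathcomp Require Export complex.
Set Implicit Arguments.
Unset Strict Implicit.
Unset Printing Implicit Defensive.
Import Order.TTheory GRing.Theory Num.Theory.
Import numFieldNormedType.Exports.
Local Open Scope ring_scope.
Local Open Scope classical_set_scope.
Local Open Scope complex_scope.

Definition cexp (R : realType) (z : R[i]) : R[i] :=
  (expR (complex.Re z) * cos (complex.Im z))
    +i* (expR (complex.Re z) * sin (complex.Im z)).

(* N^z := exp (z log N) *)
Definition natpowC (R : realType) (N : nat) (z : R[i]) : R[i] :=
  cexp (z * (ln (N%:R : R))%:C).

(* Euler-Gauss product, which defines Gamma on the whole complex plane minus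
   its poles:
     Gamma z = lim_N  N! N^z / (z (z + 1) ... (z + N)).
   Since x / 0 = 0, the value at a pole z = 0, -1, -2, ... is 0, and therefore
   (Gamma z)^-1 is the entire function 1/Gamma, poles of Gamma included (see
   invGamma_pole). The ascription to numFieldType selects the topology given
   by the complex modulus. *)
Definition Gamma (R : realType) (z : R[i]) : R[i] :=
  lim ((fun N : nat => N`!%:R * natpowC N z / \prod_(i < N.+1) (z + i%:R)
         : (R[i] : numFieldType)) @ \oo).

Lemma invGamma_pole (R : realType) (m : nat) :
  (Gamma (- m%:R : R[i]))^-1 = 0.
Proof.
rewrite /Gamma.
suff -> : lim ((fun N : nat => N`!%:R * natpowC N (- m%:R : R[i])
    / \prod_(i < N.+1) (- m%:R + i%:R) : (R[i] : numFieldType)) @ \oo) = 0.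
  by rewrite invr0.
apply: cvg_lim => //.
apply: cvg_near_cst; near=> N.
have mN : (m < N.+1)%N by rewrite ltnS; near: N; exact: nbhs_infty_ge.
by rewrite (bigD1 (Ordinal mN)) //= addNr mul0r invr0 mulr0.
Unshelve. all: by end_near. Qed.

Section Laguerre.
Context {R : realType}.
Implicit Types (alpha beta gam z : R[i]).

Definition rising gam (k : nat) : R[i] := \prod_(i < k) (gam + i%:R).

(* The falling factorial (gam)_s for a complex index s. *)
Definition falling gam (s : R[i]) : R[i] :=
  Gamma (gam + 1) / Gamma (gam - s + 1).

Definition laguerre alpha beta (n : nat) z : R[i] :=
  Gamma (alpha * n%:R + beta + 1) / Gamma (n%:R + 1) *
  \sum_(k < n.+1)
    rising (- n%:R) k / Gamma (alpha * k%:R + beta + 1) * (z ^+ k / k`!%:R).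

Definition Ccoef alpha beta (n m : nat) : R[i] :=
  (m`!%:R * n%:R)^-1 *
  \sum_(j < m.+1)
    (-1) ^+ j * 'C(m, j)%:R * (n%:R - j%:R)
      * falling (alpha * (n%:R - j%:R) + beta) alpha.

Definition Bcoef alpha beta (n m : nat) : R[i] :=
  falling (alpha * (n%:R - 1) + beta) ((m%:R - 1) * alpha)
    * Ccoef alpha beta n m.

(* acoef alpha beta z j l is a_j^(l). *)
Definition acoef alpha beta z (j l : nat) : R[i] :=
  Bcoef alpha beta (l + j)%N l - z / j.+1%:R * (l == 1%N)%:R.

End Laguerre.

(* Compositions t_1 + ... + t_k = n into positive parts; every part is at most
   n, so letting the parts range over 'I_n.+1 loses none of them. *)
Definition is_composition (n k : nat) (t : {ffun 'I_k -> 'I_n.+1}) : bool :=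
  [forall i, 0 < t i]%N && (\sum_i t i == n)%N.

(* The sum of the parts preceding position i. *)
Definition partial_sum (n k : nat) (t : {ffun 'I_k -> 'I_n.+1}) (i : 'I_k)
    : nat :=
  (\sum_(l < k | (l < i)%N) t l)%N.

(* Main.v *)
Require Import Defs.
From HB Require Import structures.
From mathcomp Require Import all_boot all_order all_algebra.
From mathcomp Require Import all_classical all_reals all_analysis.
From mathcomp Require Import ring lra zify.
Set Implicit Arguments.
Unset Strict Implicit.
Unset Printing Implicit Defensive.
Import Order.TTheory GRing.Theory Num.Theory.
Import numFieldNormedType.Exports.
Local Open Scope ring_scope.
Local Open Scope classical_set_scope.
Local Open Scope complex_scope.

(** Write g k for Gamma (alpha k + beta + 1). Every falling factorial in the
statement is a quotient of two values of g, so the theorem is an algebraic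
identity in g 0, ..., g n, valid as soon as these numbers are nonzero.

Splitting off the last part t_k = l of a composition of m leaves a composition
of m - l, and (-1)^(m - k) is the product of the signs (-1)^(t_i - 1). Hence the
right-hand side is the unique solution of
  u 0 = 1,   u m = sum_(1 <= l <= m) (-1)^(l - 1) a_(m - l)^(l) u (m - l)
(recurrence_composition_weight, sum_composition_weight), and it suffices that
the Laguerre polynomials satisfy it (gen_laguerre_recurrence).

For this, write L_m = (g m / m!) sum_k 'C(m, k) (- z)^k / g k and put
f i = i g i / g (i - 1), with f 0 = 0. Up to elementary factors B_(m, l) is the
l-th backward difference of f at m. In the coefficient of (- z)^k / g k the sum
over l is a sum of these differences against binomials 'C(m - k, l), which
binomial inversion (binomial_transformK) evaluates to f m - f k. The term f m
reproduces L_m, because f m * (g (m - 1) / m) = g m. The term f k lowers both k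
and m by one, giving (z / m) L_(m - 1), which the part - z / m of a_(m - 1)^(1)
cancels.

The analytic input is that g k != 0 (Gamma_neq0) and Gamma (n + 1) = n!
(Gamma_nat), starting from the limit that defines Gamma. Consecutive terms of
that limit have a ratio 1 + O(1 / N^2), so both the terms and their inverses
converge (cvg_of_ratio): the limit exists and is invertible. *)

(** * Second-order estimates for real elementary functions *)

Section RealEstimates.
Context {R : realType}.
Implicit Types x : R.

Lemma sin_abs_le x : `|sin x| <= `|x|.
Proof.
wlog x0 : x / 0 <= x => [hw|].
  have [/hw//|xlt0] := leP 0 x.
  by have := hw (- x); rewrite sinN !normrN; apply; rewrite oppr_ge0 ltW.
have [c _] := @MVT_segment R sin cos 0 x x0 (fun y _ => is_derive_sin y)
  (continuous_subspaceT (@continuous_sin R)).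
rewrite sin0 !subr0 => ->; rewrite normrM ler_piMl //.
exact: cos_max.
Qed.

Lemma cos_near1 x : `|cos x - 1| <= x ^+ 2 / 2.
Proof.
have -> : cos x - 1 = - (2 * sin (x / 2) ^+ 2).
  have -> : cos x = cos ((x / 2) *+ 2) by congr cos; rewrite mulr2n; lra.
  by rewrite cos_mulr2n cos2sin2 mulr2n; ring.
rewrite normrN normrM ger0_norm // normrX.
have := lerXn2r 2 (normr_ge0 _) (normr_ge0 _) (sin_abs_le (x / 2)).
rewrite [X in _ <= X -> _]real_normK ?num_real // expr_div_n.
lra.
Qed.

Lemma sin_near_id x : `|x| <= 1 -> `|sin x - x| <= x ^+ 2.
Proof.
wlog x0 : x / 0 <= x => [hw|].
  have [/hw//|xlt0] := leP 0 x.
  have := hw (- x); rewrite sinN -opprD !normrN sqrrN; apply.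
  by rewrite oppr_ge0 ltW.
rewrite ger0_norm // => x1.
have [c] := @MVT_segment R sin cos 0 x x0 (fun y _ => is_derive_sin y)
  (continuous_subspaceT (@continuous_sin R)).
rewrite sin0 !subr0 in_itv /= => /andP[c0 cx] ->.
have -> : cos c * x - x = (cos c - 1) * x by ring.
rewrite normrM (ger0_norm x0) expr2 ler_wpM2r //.
apply: le_trans (cos_near1 c) _.
nra.
Qed.

(** The upper bound comes from applying 1 + x <= exp x at - x, that is,
(1 - x) exp x <= 1. *)
Lemma expR_near_lin x : `|x| <= 2^-1 -> `|expR x - 1 - x| <= 2 * x ^+ 2.
Proof.
rewrite ler_norml => /andP[x1 x2].
have := expR_ge1Dx x; have := expR_ge1Dx (- x).
rewrite expRN => h1 h2.
have ep := expR_gt0 x.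
have h3 : (1 - x) * expR x <= 1.
  by rewrite -ler_pdivlMr // div1r.
rewrite ger0_norm; last lra.
nra.
Qed.

(** The lower bound is ln (1 + t) <= t for t = x / (1 - x), since
1 + t is the inverse of 1 - x. *)
Lemma ln_near_opp x : 0 <= x -> x <= 2^-1 ->
  - (x + 2 * x ^+ 2) <= ln (1 - x) <= - x.
Proof.
move=> x0 x1; apply/andP; split; last first.
  by apply: le_ln1Dx; lra.
have -> : ln (1 - x) = - ln (1 + x / (1 - x)).
  rewrite -lnV ?posrE.
    congr ln; field; lra.
  by rewrite ltr_pwDl // divr_ge0 //; lra.
rewrite lerN2; apply: le_trans (le_ln1Dx _) _.
  by apply: lt_le_trans (_ : 0 <= _); [lra|rewrite divr_ge0 //; lra].
rewrite ler_pdivrMr; nra.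
Qed.
End RealEstimates.

(** * The complex exponential and convergence in the l1 norm *)

Section L1Norm.
Context {R : realType}.
Implicit Types (z w : R[i]) (x : R).

(** A submultiplicative norm with values in R rather than R[i], so that order
reasoning and real limits apply to it; it is equivalent to the modulus. *)
Definition l1norm z : R := `|complex.Re z| + `|complex.Im z|.

Lemma l1norm_ge0 z : 0 <= l1norm z.
Proof. by rewrite addr_ge0. Qed.

Lemma ler_l1normD z w : l1norm (z + w) <= l1norm z + l1norm w.
Proof.
case: z w => a b [c d]; rewrite /l1norm /=.
have := ler_normD a c; have := ler_normD b d; lra.
Qed.

Lemma l1normN z : l1norm (- z) = l1norm z.
Proof. by case: z => a b; rewrite /l1norm /= !normrN. Qed.

Lemma l1normM z w : l1norm (z * w) <= l1norm z * l1norm w.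
Proof.
case: z w => a b [c d]; rewrite /l1norm /=.
have := ler_normB (a * c) (b * d); have := ler_normD (a * d) (b * c).
rewrite !normrM mulrDl !mulrDr; lra.
Qed.

Lemma l1normMr z x : l1norm (z * x%:C) = l1norm z * `|x|.
Proof.
by case: z => a b; rewrite /l1norm /= !mulr0 subr0 add0r !normrM mulrDl.
Qed.

Lemma l1norm_real x : l1norm x%:C = `|x|.
Proof. by rewrite /l1norm /= normr0 addr0. Qed.

Lemma l1norm1 : l1norm 1 = 1.
Proof. by rewrite (l1norm_real 1) normr1. Qed.

Lemma norm_le_l1norm z : `|z| <= (l1norm z)%:C.
Proof.
case: z => a b.
rewrite normc_def /= lecE /= eqxx /= /l1norm /=.
have h0 : 0 <= `|a| + `|b| by rewrite addr_ge0.
rewrite -(ler_pXn2r (_ : 0 < 2)%N) ?nnegrE ?sqrtr_ge0 // sqr_sqrtr ?addr_ge0 ?sqr_ge0 //.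
rewrite -(real_normK (num_real a)) -(real_normK (num_real b)).
have := normr_ge0 a; have := normr_ge0 b; nra.
Qed.

Lemma cexpD z w : cexp (z + w) = cexp z * cexp w.
Proof.
case: z w => a b [c d]; rewrite /cexp /=; apply/eqP; rewrite eq_complex /=.
by rewrite expRD cosD sinD; apply/andP; split; apply/eqP; ring.
Qed.

Lemma cexp0 : cexp (0 : R[i]) = 1.
Proof. by rewrite /cexp /= expR0 cos0 sin0 mulr0 mulr1. Qed.

Lemma cexp_neq0 z : cexp z != 0.
Proof.
apply/eqP => h; have : cexp (z - z) = 1 by rewrite subrr cexp0.
by rewrite cexpD h mul0r => /eqP; rewrite eq_sym oner_eq0.
Qed.

(** Both components reduce to the real estimates, by splitting
e^a cos b - 1 - a and e^a sin b - b so that each summand is of second order. *)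
Lemma cexp_near_lin z : l1norm z <= 2^-1 ->
  l1norm (cexp z - 1 - z) <= 4 * l1norm z ^+ 2.
Proof.
case: z => a b; rewrite /l1norm /= => ab.
have a0 := normr_ge0 a; have b0 := normr_ge0 b.
have ha : `|a| <= 2^-1 by lra.
have hb : `|b| <= 1 by lra.
have h1 := expR_near_lin ha; have h2 := sin_near_id hb; have h3 := cos_near1 b.
have e0 := expR_gt0 a.
have e2 : expR a <= 2.
  move: (expR_ge1Dx (- a)); rewrite expRN => h.
  have h' : (1 - a) * expR a <= 1 by rewrite -ler_pdivlMr // div1r.
  move: ha; rewrite ler_norml => /andP[_ ?]; nra.
have -> : expR a * cos b - 1 - a = expR a * (cos b - 1) + (expR a - 1 - a).
  by ring.
have -> : expR a * sin b - 0 - b = expR a * (sin b - b) + (expR a - 1) * b.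
  by ring.
have e1 : `|expR a - 1| <= 2 * `|a|.
  have -> : expR a - 1 = (expR a - 1 - a) + a by ring.
  apply: le_trans (ler_normD _ _) _.
  have : a ^+ 2 = `|a| ^+ 2 by rewrite real_normK ?num_real.
  nra.
have k1 : `|expR a * (cos b - 1)| <= 2 * (b ^+ 2 / 2).
  by rewrite normrM (gtr0_norm e0) ler_pM // ltW.
have k2 : `|expR a * (sin b - b)| <= 2 * b ^+ 2.
  by rewrite normrM (gtr0_norm e0) ler_pM // ltW.
have k3 : `|(expR a - 1) * b| <= 2 * `|a| * `|b|.
  by rewrite normrM ler_wpM2r.
have := ler_normD (expR a * (cos b - 1)) (expR a - 1 - a).
have := ler_normD (expR a * (sin b - b)) ((expR a - 1) * b).
have : a ^+ 2 = `|a| ^+ 2 by rewrite real_normK ?num_real.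
have : b ^+ 2 = `|b| ^+ 2 by rewrite real_normK ?num_real.
nra.
Qed.

Lemma cvg_of_cvgReIm (u : nat -> R[i]) (a b : R) :
  (fun N => complex.Re (u N)) @ \oo --> a ->
  (fun N => complex.Im (u N)) @ \oo --> b ->
  (u : nat -> (R[i] : numFieldType)) @ \oo --> ((a +i* b) : (R[i] : numFieldType)).
Proof.
move=> /cvgrPdist_le ha /cvgrPdist_le hb.
apply/cvgrPdist_le => -[e e'].
rewrite ltcE /= => /andP[/eqP -> e0].
have e20 : 0 < e / 2 by rewrite divr_gt0.
near=> N.
apply: le_trans (norm_le_l1norm _) _.
rewrite lecE /= eqxx /= /l1norm.
have : `|a - complex.Re (u N)| <= e / 2 by near: N; exact: ha.
have : `|b - complex.Im (u N)| <= e / 2 by near: N; exact: hb.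
case: (u N) => c d /=; lra.
Unshelve. all: by end_near. Qed.

(** x + s is nonincreasing and x - s is nondecreasing, so x + s converges, and
so does s. *)
Lemma real_cvg_of_increments (x s : nat -> R) :
  (forall N, 0 <= s N) ->
  (forall N, `|x N.+1 - x N| <= s N - s N.+1) -> cvgn x.
Proof.
move=> s0 hx.
have cs : cvgn s.
  apply: nonincreasing_is_cvgn.
    apply/nonincreasing_seqP => N; have := normr_ge0 (x N.+1 - x N).
    by have := hx N; lra.
  by exists 0 => _ [N _ <-].
have cxs : cvgn (x \+ s).
  apply: nonincreasing_is_cvgn.
    apply/nonincreasing_seqP => N /=; move: (hx N).
    by rewrite ler_norml => /andP[_]; lra.
  exists (x 0%N - s 0%N) => _ [N _ <-] /=.
  suff : x 0%N - s 0%N <= x N - s N by have := s0 N; lra.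
  elim: N => // N ih; apply: le_trans ih _; move: (hx N).
  by rewrite ler_norml => /andP[+ _]; lra.
have -> : x = (x \+ s) \- s by apply/funext => N /=; rewrite addrK.
exact: is_cvgB.
Qed.

(** Convergence of an infinite product of factors 1 + w N with
|w N| <= s N - s (N + 1). The partial products are bounded by a multiple of
exp (s 0), since 1 + x <= exp x, so their increments are bounded by a telescoping
series. *)
Lemma cvg_of_ratio (P : nat -> R[i]) (s : nat -> R) :
  (forall N, 0 <= s N) ->
  (forall N, l1norm (P N.+1 - P N) <= l1norm (P N) * (s N - s N.+1)) ->
  (forall N, s N.+1 <= s N) ->
  exists l : R[i], (P : nat -> (R[i] : numFieldType)) @ \oo --> (l : (R[i] : numFieldType)).
Proof.
move=> s0 hP sd.
pose M := l1norm (P 0%N) * expR (s 0%N).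
have M0 : 0 <= M by rewrite mulr_ge0 ?l1norm_ge0 ?expR_ge0.
have bP N : l1norm (P N) <= l1norm (P 0%N) * expR (s 0%N - s N).
  elim: N => [|N ih]; first by rewrite subrr expR0 mulr1.
  have -> : P N.+1 = P N + (P N.+1 - P N) by rewrite addrC subrK.
  apply: le_trans (ler_l1normD _ _) _.
  have -> : s 0%N - s N.+1 = (s 0%N - s N) + (s N - s N.+1) by ring.
  rewrite expRD mulrA.
  apply: (@le_trans _ _ (l1norm (P N) * (1 + (s N - s N.+1)))).
    by rewrite mulrDr mulr1 lerD2l.
  apply: ler_pM => //; rewrite ?l1norm_ge0 //; last exact: expR_ge1Dx.
  by have := sd N; lra.
have hM N : l1norm (P N.+1 - P N) <= M * s N - M * s N.+1.
  rewrite -mulrBr; apply: le_trans (hP N) _; rewrite ler_wpM2r ?subr_ge0 //.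
  apply: le_trans (bP N) _; rewrite ler_wpM2l ?l1norm_ge0 // ler_expR.
  by have := s0 N; lra.
have Ms0 N : 0 <= M * s N by rewrite mulr_ge0.
have cRe : cvgn (fun N => complex.Re (P N)).
  apply: (real_cvg_of_increments Ms0) => N; apply: le_trans (hM N).
  by rewrite /l1norm; case: (P N) => a b; case: (P N.+1) => c d /=; rewrite lerDl.
have cIm : cvgn (fun N => complex.Im (P N)).
  apply: (real_cvg_of_increments Ms0) => N; apply: le_trans (hM N).
  by rewrite /l1norm; case: (P N) => a b; case: (P N.+1) => c d /=; rewrite lerDr.
by eexists; exact: cvg_of_cvgReIm cRe cIm.
Qed.

End L1Norm.

(** * Values of Gamma *)

(** Stated over an arbitrary numFieldType, where the limit laws apply directly;
the inverse sequence tends to 1 + (z + 1) * 0. *)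
Lemma cvg_shift_ratio_of_invn (K : numFieldType) (z : K) :
  (fun N => N%:R^-1 : K) @ \oo --> (0 : K) ->
  (fun N => N%:R / (z + N.+1%:R) : K) @ \oo --> (1 : K).
Proof.
move=> hv.
have hw : (fun N => 1 + (z + 1) * N%:R^-1 : K) @ \oo --> (1 : K).
  rewrite -[X in _ --> X]addr0 -[X in _ --> _ + X](mulr0 (z + 1)).
  by apply: cvgD; [exact: cvg_cst | apply: cvgM => //; exact: cvg_cst].
have hi : (fun N => (1 + (z + 1) * N%:R^-1)^-1 : K) @ \oo --> (1 : K).
  by rewrite -[X in _ --> X]invr1; apply: cvgV => //; exact: oner_neq0.
apply: cvg_trans hi.
apply: near_eq_cvg; near=> N.
have N0 : (0 < N)%N by near: N; exact: nbhs_infty_gt.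
have Nc : (N%:R : K) != 0 by rewrite pnatr_eq0 -lt0n.
have -> : N%:R / (z + N.+1%:R) = ((z + N.+1%:R) / N%:R)^-1 by rewrite invf_div.
by congr (_^-1); rewrite -natr1; field; exact: Nc.
Unshelve. all: by end_near. Qed.

Section GammaFacts.
Context {R : realType}.
Implicit Types (z : R[i]).

Definition gauss z (N : nat) : R[i] :=
  N`!%:R * natpowC N z / \prod_(i < N.+1) (z + i%:R).

(** For h = 1 / (N + 1) this is the ratio gauss z N / gauss z (N + 1): the
logarithm comes from ln N - ln (N + 1) = ln (1 - h). *)
Definition gauss_step z (h : R) : R[i] :=
  (1 + z * h%:C) * cexp (z * (ln (1 - h))%:C).

(** The first-order terms z h and - z h of the two factors cancel. *)
Lemma gauss_step_near1 z (h : R) : let K := l1norm z in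
  0 <= h -> h <= 2^-1 -> 4 * K * h <= 1 ->
  l1norm (gauss_step z h - 1) <= (2 * K + 34 * K ^+ 2) * h ^+ 2.
Proof.
move=> K h0 h2 Kh.
have K0 : 0 <= K by exact: l1norm_ge0.
have /andP[ln1 ln2] := ln_near_opp h0 h2.
set e := ln (1 - h) in ln1 ln2 *.
pose W := z * e%:C.
have lW : l1norm W <= 2 * K * h.
  rewrite /W l1normMr -/K ler0_norm; last lra.
  have : - e <= 2 * h by nra.
  nra.
have lWh : l1norm (W + z * h%:C) <= 2 * K * h ^+ 2.
  rewrite /W -mulrDr -rmorphD l1normMr -/K.
  have : `|e + h| <= 2 * h ^+ 2 by rewrite ler_norml; apply/andP; split; lra.
  nra.
pose rho := cexp W - 1 - W.
have lr : l1norm rho <= 16 * K ^+ 2 * h ^+ 2.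
  apply: le_trans (cexp_near_lin _) _; first lra.
  have := l1norm_ge0 W; nra.
have -> : gauss_step z h - 1 = (W + z * h%:C) + (z * h%:C * W + (1 + z * h%:C) * rho).
  by rewrite /gauss_step -/e -/W /rho; ring.
apply: le_trans (ler_l1normD _ _) _.
have lzh : l1norm (z * h%:C) = K * h by rewrite l1normMr ger0_norm.
have t1 : l1norm (z * h%:C * W) <= 2 * K ^+ 2 * h ^+ 2.
  apply: le_trans (l1normM _ _) _; rewrite lzh.
  have := l1norm_ge0 W; nra.
have t2 : l1norm ((1 + z * h%:C) * rho) <= 2 * (16 * K ^+ 2 * h ^+ 2).
  apply: le_trans (l1normM _ _) _; apply: ler_pM; rewrite ?l1norm_ge0 //.
  by apply: le_trans (ler_l1normD _ _) _; rewrite lzh l1norm1; lra.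
have := ler_l1normD (z * h%:C * W) ((1 + z * h%:C) * rho).
lra.
Qed.

Lemma gaussS z (N : nat) : (0 < N)%N -> z + N.+1%:R != 0 ->
  gauss z N.+1 * gauss_step z (N.+1%:R)^-1 = gauss z N.
Proof.
move=> N0 zN; rewrite /gauss /gauss_step big_ord_recr /= /natpowC.
have N1 : (N.+1%:R : R) != 0 by rewrite pnatr_eq0.
have N1c : (N.+1%:R : R[i]) != 0 by rewrite pnatr_eq0.
have -> : cexp (z * (ln (N%:R : R))%:C) =
   cexp (z * (ln (N.+1%:R : R))%:C) * cexp (z * (ln (1 - N.+1%:R^-1 : R))%:C).
  rewrite -cexpD -mulrDr -rmorphD -lnM; last 2 first.
  - by rewrite posrE ltr0n.
  - by rewrite posrE subr_gt0 invf_lt1 ?ltr1n ?ltr0n.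
  by rewrite mulrBr mulr1 divff // -natr1 addrK.
have -> : 1 + z * (N.+1%:R^-1 : R)%:C = (z + N.+1%:R) / N.+1%:R.
  by rewrite fmorphV rmorph_nat addrC mulrDl divff.
rewrite factS natrM invfM.
set p := (\prod_(i < _) _)^-1; field.
by rewrite [1 + _]addrC natr1 N1c.
Qed.

Lemma gauss_neq0 z (N : nat) : (forall m : nat, z <> - m%:R) -> gauss z N != 0.
Proof.
move=> hz; rewrite /gauss !mulf_neq0 //; last 2 first.
- exact: cexp_neq0.
- rewrite invr_eq0; apply/prodf_neq0 => i _; rewrite addr_eq0; apply/eqP; exact: hz.
Qed.

(** Off the poles no term of the sequence vanishes; both it and the sequence of
inverses converge by cvg_of_ratio, and the two limits are inverse to each other,
which makes the limit nonzero. *)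
Lemma cvg_gauss z : (forall m : nat, z <> - m%:R) ->
  exists2 l : R[i], l != 0 &
   (gauss z : nat -> (R[i] : numFieldType)) @ \oo --> (l : (R[i] : numFieldType)).
Proof.
move=> hz.
pose K := l1norm z; pose D := 2 * K + 34 * K ^+ 2.
have K0 : 0 <= K by exact: l1norm_ge0.
have D0 : 0 <= D by rewrite /D; nra.
(* From the index N0 on, the step h satisfies 4 K h <= 1 and D h <= 1/2, so
   that the deviation of the ratio from 1 is at most 1/2. *)
pose N0 := (Num.truncn (4 * K + 2 * D)).+1.
have hN0 : 4 * K + 2 * D < N0%:R by exact: truncnS_gt.
pose t (N : nat) : R := (N + N0)%:R^-1.
(* D * t would suffice for the inverses; the factor 2 bounds the inverse of
   1 + w N in the ratios of the sequence itself. *)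
pose s N := 2 * D * t N.
have t0 N : 0 < t N by rewrite invr_gt0 ltr0n addnS.
(* h^2 <= 1 / (N (N + 1)) telescopes. *)
have tS N : t N = t N.+1 + t N * t N.+1.
  rewrite /t addSn -[(N + N0).+1]addn1 natrD.
  have : 0 < (N + N0)%:R :> R by rewrite ltr0n addnS.
  by move=> h; field; lra.
have tN0 N : t N * N0%:R <= 1.
  rewrite mulrC ler_pdivrMr ?ltr0n ?addnS // mul1r ler_nat.
  by rewrite -addnS leq_addl.
have t1 N : t N.+1 <= 2^-1.
  by rewrite lef_pV2 ?posrE ?ltr0n // ler_nat addSn addnS.
pose w N := gauss_step z (t N.+1) - 1.
have hw N : l1norm (w N) <= D * (t N - t N.+1) /\ l1norm (w N) <= 2^-1.
  have h1 := t0 N.+1; have h2 := tS N; have h3 := tN0 N.+1; have h4 := t1 N.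
  have h5 := t0 N.
  have h6 : l1norm (w N) <= D * t N.+1 ^+ 2.
    by apply: gauss_step_near1 => //; [exact: ltW | rewrite -/K; nra].
  split; apply: le_trans h6 _.
    by rewrite ler_wpM2l //; nra.
  have h7 : D * t N.+1 <= 2^-1 by nra.
  nra.
have s0 N : 0 <= s N by rewrite /s !mulr_ge0 // ltW.
have sd N : s N.+1 <= s N.
  by rewrite /s ler_wpM2l ?mulr_ge0 // [leRHS]tS lerDl mulr_ge0 // ltW.
pose P N := gauss z (N + N0)%N.
have P0 N : P N != 0 by exact: gauss_neq0.
have hP N : P N.+1 * (1 + w N) = P N.
  rewrite /w addrC subrK /P /t addSn gaussS ?addnS //.
  by rewrite addr_eq0; apply/eqP; exact: hz.
have [a ha] : exists l : R[i], ((fun N => (P N)^-1) : nat -> (R[i] : numFieldType)) @ \oo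
     --> (l : (R[i] : numFieldType)).
  apply: (cvg_of_ratio s0) sd => N.
  have w0 : 1 + w N != 0.
    by apply: contraNneq (P0 N) => w0; rewrite -(hP N) w0 mulr0.
  have -> : (P N.+1)^-1 - (P N)^-1 = (P N)^-1 * w N.
    by rewrite -(hP N); field; rewrite P0 w0.
  apply: le_trans (l1normM _ _) _; rewrite ler_wpM2l ?l1norm_ge0 //.
  have [h _] := hw N; apply: le_trans h _; rewrite /s.
  have := tS N; have := t0 N; have := t0 N.+1; nra.
have [b hb] : exists l : R[i], (P : nat -> (R[i] : numFieldType)) @ \oo
     --> (l : (R[i] : numFieldType)).
  apply: (cvg_of_ratio s0) sd => N.
  have w0 : 1 + w N != 0.
    by apply: contraNneq (P0 N) => w0; rewrite -(hP N) w0 mulr0.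
  pose x := (1 + w N)^-1.
  have [h h'] := hw N.
  have lx : l1norm x <= 2.
    have : l1norm x <= 1 + l1norm x * l1norm (w N).
      have {1}-> : x = 1 - x * w N by rewrite /x; field.
      apply: le_trans (ler_l1normD _ _) _.
      by rewrite l1normN l1norm1 lerD2l l1normM.
    have := l1norm_ge0 x; nra.
  have -> : P N.+1 - P N = P N * - (x * w N).
    by rewrite -(hP N) /x; field.
  apply: le_trans (l1normM _ _) _; rewrite ler_wpM2l ?l1norm_ge0 //.
  rewrite l1normN; apply: le_trans (l1normM _ _) _.
  rewrite /s -mulrBr -mulrA; apply: ler_pM => //; exact: l1norm_ge0.
exists b; last by rewrite -(cvg_shiftn N0).
have : b * a = 1.
  apply: (@cvg_unique _ (@norm_hausdorff _ (R[i] : numFieldType)) _ _ _ _ (cvgM hb ha)).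
  apply: cvg_near_cst; near=> N; exact: divff.
by move=> ba; apply/eqP => b0; move: ba; rewrite b0 mul0r => /eqP; rewrite eq_sym oner_eq0.
Unshelve. all: by end_near. Qed.

Lemma Gamma_eq_lim z (l : R[i]) :
  (gauss z : nat -> (R[i] : numFieldType)) @ \oo --> (l : (R[i] : numFieldType)) ->
  Gamma z = l.
Proof.
by move=> hl; rewrite /Gamma; apply: cvg_lim hl; exact: norm_hausdorff.
Qed.

Lemma cvg_gauss_Gamma z : (forall m : nat, z <> - m%:R) ->
  (gauss z : nat -> (R[i] : numFieldType)) @ \oo --> (Gamma z : (R[i] : numFieldType)).
Proof.
move=> /cvg_gauss[l _ hl]; by rewrite (Gamma_eq_lim hl).
Qed.

Lemma Gamma_neq0 z : (forall m : nat, z <> - m%:R) -> Gamma z != 0.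
Proof.
move=> /cvg_gauss[l l0 hl]; by rewrite (Gamma_eq_lim hl).
Qed.

Lemma natpowC1 (N : nat) : (0 < N)%N -> natpowC N (1 : R[i]) = N%:R.
Proof.
move=> N0; rewrite /natpowC mul1r /cexp /= cos0 sin0 mulr0 mulr1.
by rewrite lnK ?posrE ?ltr0n // -(rmorph_nat (real_complex R)).
Qed.

Lemma natpowCD (N : nat) (z w : R[i]) :
  natpowC N (z + w) = natpowC N z * natpowC N w.
Proof. by rewrite /natpowC mulrDl cexpD. Qed.

Lemma cvg_shift_ratio z :
  ((fun N => N%:R / (z + N.+1%:R)) : nat -> (R[i] : numFieldType)) @ \oo -->
    (1 : (R[i] : numFieldType)).
Proof.
apply: cvg_shift_ratio_of_invn.
have hR (N : nat) : (N%:R^-1 : R[i]) = (N%:R^-1 : R)%:C.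
  by rewrite fmorphV rmorph_nat.
have h0 : (fun N : nat => N%:R^-1 : R) @ \oo --> (0 : R).
  rewrite -(cvg_shiftS (fun N => N%:R^-1 : R)); exact: cvg_harmonic.
apply: (@cvg_of_cvgReIm _ _ 0 0); under eq_fun do rewrite hR /=.
  exact: h0.
exact: cvg_cst.
Qed.

Lemma gaussD1 z (N : nat) : (0 < N)%N -> (forall m : nat, z <> - m%:R) ->
  gauss (z + 1) N = z * gauss z N * (N%:R / (z + N.+1%:R)).
Proof.
move=> N0 hz; rewrite /gauss natpowCD natpowC1 //.
have z0 m : z + m%:R != 0 by rewrite addr_eq0; apply/eqP; exact: hz.
have z00 : z != 0 by have := z0 0%N; rewrite addr0.
have hprod : \prod_(i < N.+1) (z + 1 + i%:R) =
    (\prod_(i < N.+1) (z + i%:R)) * (z + N.+1%:R) / z.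
  apply: (mulIf z00); rewrite divfK //.
  transitivity (\prod_(i < N.+2) (z + i%:R)); last by rewrite big_ord_recr.
  rewrite [RHS]big_ord_recl /= addr0 [RHS]mulrC.
  congr (_ * _); apply: eq_bigr => i _.
  by rewrite /bump /= add1n -natr1; ring.
rewrite hprod; set p := \prod_(i < _) _.
have p0 : p != 0 by apply/prodf_neq0.
have := z0 N.+1; set q := z + N.+1%:R => q0.
by field; rewrite p0 q0 z00.
Qed.

(** By gaussD1, the sequences at z + 1 and z have a ratio tending to z. *)
Lemma GammaS z : (forall m : nat, z <> - m%:R) -> Gamma (z + 1) = z * Gamma z.
Proof.
move=> hz; apply: Gamma_eq_lim; rewrite -[X in _ --> X]mulr1.
have hc : (fun N => z * gauss z N * (N%:R / (z + N.+1%:R)) : (R[i] : numFieldType))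
   @ \oo --> (z * Gamma z * 1 : (R[i] : numFieldType)).
  apply: cvgM (cvg_shift_ratio z).
  by apply: cvgM; [exact: cvg_cst | exact: cvg_gauss_Gamma].
apply: cvg_trans hc; apply: near_eq_cvg; near=> N.
rewrite -gaussD1 //; near: N; exact: nbhs_infty_gt.
Unshelve. all: by end_near. Qed.

Lemma Gamma1 : Gamma (1 : R[i]) = 1.
Proof.
apply: Gamma_eq_lim; apply: cvg_trans (cvg_shift_ratio 0); apply: near_eq_cvg; near=> N.
have N0 : (0 < N)%N by near: N; exact: nbhs_infty_gt.
rewrite /gauss natpowC1 // add0r.
have -> : \prod_(i < N.+1) (1 + i%:R) = (N.+1)`!%:R :> R[i].
  elim: N.+1 => [|m ih]; first by rewrite big_ord0.
  by rewrite big_ord_recr /= ih factS mulnC natrM nat1r.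
rewrite factS natrM.
have h1 : N.+1%:R != 0 :> R[i] by rewrite pnatr_eq0.
have h2 : N`!%:R != 0 :> R[i] by rewrite pnatr_eq0 -lt0n fact_gt0.
by rewrite [_.+1%:R * _]mulrC -mulf_div divff // mul1r.
Unshelve. all: by end_near. Qed.

Lemma Gamma_nat (n : nat) : Gamma (n%:R + 1 : R[i]) = n`!%:R.
Proof.
elim: n => [|n ih]; first by rewrite add0r Gamma1.
rewrite -natr1 GammaS; last first.
  move=> m /eqP; rewrite -subr_eq0 opprK natr1 -natrD pnatr_eq0.
  by rewrite addSn.
by rewrite ih natr1 factS natrM.
Qed.
End GammaFacts.

(** * Sums over compositions *)

Section Compositions.
Context (K : comNzRingType) (a : nat -> nat -> K).

(** The sum, over compositions of m into k parts, of the products of weights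
a (sum of the preceding parts) (part), computed by splitting off the last part
l, which is preceded by parts of sum m - l. *)
Fixpoint composition_weight (k m : nat) : K :=
  if k is k'.+1 then
    \sum_(1 <= l < m.+1) a (m - l) l * composition_weight k' (m - l)
  else (m == 0%N)%:R.

(** Appends an entry; ord_max is the position of the new last entry. *)
Definition ffun_rcons (k M : nat) (p : {ffun 'I_k -> 'I_M} * 'I_M) :
    {ffun 'I_k.+1 -> 'I_M} :=
  [ffun i => if unlift ord_max i is Some j then p.1 j else p.2].

Lemma ffun_rcons_last k M (p : {ffun 'I_k -> 'I_M} * 'I_M) :
  ffun_rcons p ord_max = p.2.
Proof. by rewrite ffunE unlift_none. Qed.

Lemma widen_ord_lift_max k (i : 'I_k) :
  widen_ord (leqnSn k) i = lift ord_max i.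
Proof. by apply: val_inj; rewrite [RHS]lift_max. Qed.

Lemma ffun_rcons_widen k M (p : {ffun 'I_k -> 'I_M} * 'I_M) i :
  ffun_rcons p (widen_ord (leqnSn k) i) = p.1 i.
Proof. by rewrite ffunE widen_ord_lift_max liftK. Qed.

Lemma ffun_rcons_bij k M : bijective (@ffun_rcons k M).
Proof.
exists (fun t : {ffun 'I_k.+1 -> 'I_M} => ([ffun i => t (widen_ord (leqnSn k) i)], t ord_max)).
  move=> [t x]; rewrite ffun_rcons_last; congr (_, _).
  by apply/ffunP => i; rewrite ffunE ffun_rcons_widen.
move=> t; apply/ffunP => i; rewrite ffunE; case: unliftP => [j|] -> //=.
by rewrite ffunE widen_ord_lift_max.
Qed.

(** Unlike in is_composition, the total m is independent of the bound M on the
parts: an induction that splits off parts lowers m while the type of the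
compositions has to stay the same. *)
Definition composition_of (k M m : nat) (t : {ffun 'I_k -> 'I_M}) : bool :=
  [forall i, 0 < t i]%N && (\sum_i t i == m)%N.

Lemma composition_of_rcons k M m (t : {ffun 'I_k -> 'I_M}) (x : 'I_M) :
  composition_of m (ffun_rcons (t, x)) =
  ((0 < x)%N && (x <= m)%N) && composition_of (m - x) t.
Proof.
rewrite /composition_of big_ord_recr /= ffun_rcons_last /=.
under eq_bigr do rewrite ffun_rcons_widen /=.
have -> : [forall i, 0 < ffun_rcons (t, x) i]%N = (0 < x)%N && [forall i, 0 < t i]%N.
  apply/forallP/andP => [h|[h1 /forallP h2] i].
    split; first by have := h ord_max; rewrite ffun_rcons_last.
    by apply/forallP => i; have := h (widen_ord (leqnSn k) i); rewrite ffun_rcons_widen.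
  by rewrite ffunE; case: unliftP => [j|] _ //=.
rewrite -!andbA; congr (_ && _); rewrite andbCA; congr (_ && _).
have [xm|xm] := leqP x m; first by rewrite -{1}(subnK xm) eqn_add2r.
apply/negbTE; apply: contraTN xm => /eqP <-; rewrite -leqNgt; exact: leq_addl.
Qed.

Lemma partial_sum_rcons n k (t : {ffun 'I_k -> 'I_n.+1}) (x : 'I_n.+1) i :
  partial_sum (ffun_rcons (t, x)) (widen_ord (leqnSn k) i) = partial_sum t i.
Proof.
rewrite /partial_sum big_mkcond big_ord_recr /= ltnNge (ltnW (ltn_ord i)) /= addn0.
by rewrite [RHS]big_mkcond /=; apply: eq_bigr => j _; rewrite ffun_rcons_widen.
Qed.

Lemma partial_sum_rcons_last n k (t : {ffun 'I_k -> 'I_n.+1}) (x : 'I_n.+1) :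
  partial_sum (ffun_rcons (t, x)) ord_max = (\sum_i t i)%N.
Proof.
rewrite /partial_sum big_mkcond big_ord_recr /= ltnn addn0.
by apply: eq_bigr => j _; rewrite ffun_rcons_widen /= ltn_ord.
Qed.

(** Induction on k along the bijection ffun_rcons. *)
Lemma sum_composition_weight n k m : (m <= n)%N ->
  \sum_(t : {ffun 'I_k -> 'I_n.+1} | composition_of m t)
    \prod_(i < k) a (partial_sum t i) (t i) = composition_weight k m.
Proof.
elim: k m => [|k ih] m mn /=.
  have t0 : {ffun 'I_0 -> 'I_n.+1} by exact: [ffun=> ord0].
  have tt0 (t : {ffun 'I_0 -> 'I_n.+1}) : t = t0 by apply/ffunP => -[].
  have c0 (t : {ffun 'I_0 -> 'I_n.+1}) : composition_of m t = (m == 0%N).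
    rewrite /composition_of big_ord0 eq_sym.
    by have -> : [forall i, 0 < t i]%N by apply/forallP => -[].
  case: (m == 0%N) c0 => c0; last by rewrite big1 // => t; rewrite c0.
  by rewrite (big_pred1 t0) ?big_ord0 // => t; rewrite c0 /= (tt0 t) eqxx.
rewrite (reindex (@ffun_rcons k n.+1)); last exact: onW_bij (ffun_rcons_bij _ _).
have -> : \sum_(1 <= l < m.+1) a (m - l) l * composition_weight k (m - l) =
   \sum_(l < n.+1 | (0 < l)%N && (l <= m)%N) a (m - l) l * composition_weight k (m - l).
  rewrite -(big_mkord (fun l => (0 < l)%N && (l <= m)%N)
     (fun l => a (m - l) l * composition_weight k (m - l))).
  rewrite (big_nat_widen _ _ _ _ _ (_ : m.+1 <= n.+1)%N) //.
  by rewrite (big_nat_widenl _ 0%N) //; apply: eq_bigl => l; rewrite ltnS andbC.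
have -> : \sum_(l < n.+1 | (0 < l)%N && (l <= m)%N) a (m - l) l * composition_weight k (m - l)
  = \sum_(l < n.+1 | (0 < l)%N && (l <= m)%N)
   \sum_(t : {ffun 'I_k -> 'I_n.+1} | composition_of (m - l) t)
      a (m - l) l * \prod_(i < k) a (partial_sum t i) (t i).
  apply: eq_bigr => l _; rewrite -ih ?mulr_sumr //.
  by rewrite (leq_trans (leq_subr _ _)).
rewrite (exchange_big_dep xpredT) //= pair_big_dep /=.
apply: eq_big => [[t x]|[t x]] /=; rewrite composition_of_rcons //.
move=> /andP[_ /andP[_ /eqP tm]].
rewrite big_ord_recr /= ffun_rcons_last partial_sum_rcons_last tm mulrC.
by congr (_ * _); apply: eq_bigr => i _; rewrite partial_sum_rcons ffun_rcons_widen.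
Qed.

(** The number of parts of a composition of m is at most m, so any range M > m
for k gives the same sum. Allowing all these M lets the induction lower M by
one, which is the number of parts split off, whatever the size of that part. *)
Lemma recurrence_composition_weight (u : nat -> K) (n : nat) :
  u 0%N = 1 ->
  (forall m, (0 < m)%N -> (m <= n)%N ->
     u m = \sum_(1 <= l < m.+1) (-1) ^+ l.-1 * a (m - l) l * u (m - l)%N) ->
  forall m M, (m <= n)%N -> (m < M)%N ->
    u m = \sum_(k < M) (-1) ^+ (m + k) * composition_weight k m.
Proof.
move=> u0 uS m; have [N] := ubnP m; elim: N m => // N ih m mN M mn.
case: M => // M mM; rewrite big_ord_recl /= addn0.
have [-> | m0] := posnP m.
  rewrite u0 expr0 mulr1 big1 ?addr0 // => i _.
  by rewrite /= big_geq ?mulr0.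
rewrite mulr0 add0r uS //.
under [RHS]eq_bigr do rewrite mulr_sumr.
rewrite exchange_big /=; apply: eq_big_nat => l /andP[l0 lm].
have ml : (m - l < m)%N by rewrite ltn_subrL l0 m0.
rewrite (ih _ (leq_trans ml mN) M (leq_trans (leq_subr _ _) mn) (leq_trans ml mM)).
rewrite mulr_sumr; apply: eq_bigr => i _.
(* The exponents differ by 2 because the recurrence carries the sign l - 1. *)
have -> : (m + bump 0 i = l.-1 + (m - l + i) + 2)%N by rewrite /bump; lia.
by rewrite !exprD sqrrN expr1n; ring.
Qed.
End Compositions.

(** * Binomial inversion *)

Section BinomialTransform.
Context (K : comNzRingType).
Implicit Types h : nat -> K.

(** The l-th backward difference of f at m is the transform at l of
j |-> f (m - j). *)
Definition binomial_transform h (l : nat) : K :=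
  \sum_(j < l.+1) (-1) ^+ j * 'C(l, j)%:R * h j.

(** Pascal's rule. *)
Lemma binomial_transformS h l :
  binomial_transform h l.+1 =
  binomial_transform h l - binomial_transform (fun j => h j.+1) l.
Proof.
rewrite /binomial_transform big_ord_recl.
have -> : \sum_(j < l.+1) (-1) ^+ j * 'C(l, j)%:R * h j =
          \sum_(j < l.+2) (-1) ^+ j * 'C(l, j)%:R * h j.
  by rewrite [RHS]big_ord_recr /= bin_small // mulr0 mul0r addr0.
rewrite [in RHS]big_ord_recl -addrA -sumrB !bin0; congr (_ + _).
by apply: eq_bigr => i _; rewrite /= /bump /= add1n binS natrD exprS; ring.
Qed.

(** With T the transform and S the shift, Pascal's rule reads
(T h) (l + 1) = (T h - T (S h)) l, that is S T = T - T S, so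
S (T T h) = T (T h) - T (S T h) = T T (S h). Thus T T commutes with S, and it
preserves the value at 0. *)
Lemma binomial_transformK h N :
  binomial_transform (binomial_transform h) N = h N.
Proof.
elim: N h => [|N ih] h.
  by rewrite /binomial_transform !big_ord1 !bin0 !expr0 !mul1r.
rewrite binomial_transformS -[RHS](ih (fun j => h j.+1)) /binomial_transform.
rewrite -sumrB; apply: eq_bigr => i _; rewrite -mulrBr; congr (_ * _).
by have := binomial_transformS h i; rewrite /binomial_transform => ->; ring.
Qed.

End BinomialTransform.

(** Choosing k among the m - l elements outside an l-subset is choosing the
l-subset among the m - k elements outside a k-subset. *)
Lemma bin_fact_swap (m l k : nat) : (l <= m)%N ->
  (m`! * 'C(m - l, k) = l`! * (m - l)`! * ('C(m, k) * 'C(m - k, l)))%N.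
Proof.
move=> lm; have [kml|kml] := leqP k (m - l); last first.
  rewrite bin_small // muln0; have [km|mk] := leqP k m.
    by rewrite [X in (_ * (_ * X))%N]bin_small ?muln0 //; lia.
  by rewrite [X in (_ * (X * _))%N]bin_small ?muln0.
have km : (k <= m)%N by lia.
have lmk : (l <= m - k)%N by lia.
have := bin_fact kml; have := bin_fact km; have := bin_fact lmk.
have -> : (m - k - l = m - l - k)%N by lia.
move=> <- <- <-; ring.
Qed.

(** * The recurrence for generalized Laguerre polynomials *)

Section Recurrence.
Context (K : numFieldType) (g : nat -> K) (z : K).

(** The function whose backward differences are the coefficients C_(n, m). At 0
the factor i kills the ratio, whose denominator would be g (-1). *)
Definition weighted_ratio (i : nat) : K := i%:R * (g i / g i.-1).

(** The generalized Laguerre polynomial for an arbitrary sequence g in place of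
Gamma (alpha k + beta + 1). *)
Definition gen_laguerre (m : nat) : K :=
  g m / m`!%:R * \sum_(k < m.+1) 'C(m, k)%:R * ((- z) ^+ k / g k).

Lemma gen_laguerre_widen m M : (m <= M)%N ->
  gen_laguerre m = g m / m`!%:R * \sum_(k < M.+1) 'C(m, k)%:R * ((- z) ^+ k / g k).
Proof.
move=> mM; congr (_ * _).
rewrite (big_ord_widen M.+1 (fun k => 'C(m, k)%:R * ((- z) ^+ k / g k))) //.
rewrite big_mkcond; apply: eq_bigr => k _; case: ltnP => // mk.
by rewrite bin_small ?mul0r.
Qed.

(** By k 'C(m, k) = m 'C(m - 1, k - 1), and because the factor g k of
weighted_ratio k turns 1 / g k into 1 / g (k - 1). *)
Lemma sum_weighted_ratio m : (0 < m)%N -> (forall i, (i <= m)%N -> g i != 0) ->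
  g m.-1 / (m`!%:R * m%:R) *
   \sum_(k < m.+1) 'C(m, k)%:R * ((- z) ^+ k / g k) * weighted_ratio k =
  - (z / m%:R) * gen_laguerre m.-1.
Proof.
case: m => // m _ gn; rewrite /= big_ord_recl {1}/weighted_ratio mul0r mulr0 add0r.
rewrite /gen_laguerre !mulr_sumr; apply: eq_bigr => k _.
rewrite /weighted_ratio !lift0 /=.
have gk : g k != 0 by apply: gn; rewrite ltnW // ltnS ltnW.
have gk1 : g k.+1 != 0 by apply: gn; rewrite ltnS -ltnS.
have hb : k.+1%:R * 'C(m.+1, k.+1)%:R = m.+1%:R * 'C(m, k)%:R :> K.
  by rewrite -!natrM -mul_bin_diag.
have m1 : m.+1%:R != 0 :> K by rewrite pnatr_eq0.
have mf : m`!%:R != 0 :> K by rewrite pnatr_eq0 -lt0n fact_gt0.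
rewrite factS natrM exprS.
transitivity (g m / (m.+1%:R * m`!%:R * m.+1%:R) * (- z * (- z) ^+ k / g k) *
   (k.+1%:R * 'C(m.+1, k.+1)%:R)).
  move: (m.+1%:R) m1 (g k.+1) gk1 => a a0 b b0.
  by field; rewrite a0 mf gk b0.
rewrite hb.
move: (m.+1%:R) m1 => a a0.
by field; rewrite a0 mf gk.
Qed.

(** Binomial inversion at m - k, with the term l = 0 moved to the other side;
the terms with l > m - k vanish. *)
Lemma sum_binomial_differences m k : (k <= m)%N ->
  \sum_(1 <= l < m.+1) (-1) ^+ l.-1 * 'C(m - k, l)%:R *
     binomial_transform (fun j => weighted_ratio (m - j)) l
  = weighted_ratio m - weighted_ratio k.
Proof.
move=> km; set D := binomial_transform _.
have h := binomial_transformK (fun j => weighted_ratio (m - j)) (m - k).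
rewrite subKn // in h; rewrite -h -/D.
have D0 : D 0%N = weighted_ratio m.
  by rewrite /D /binomial_transform big_ord1 bin0 !mul1r subn0.
have -> : binomial_transform D (m - k) = \sum_(l < m.+1) (-1) ^+ l * 'C(m - k, l)%:R * D l.
  rewrite /binomial_transform.
  rewrite (big_ord_widen m.+1 (fun l => (-1) ^+ l * 'C(m - k, l)%:R * D l)).
    rewrite big_mkcond; apply: eq_bigr => l _; case: ltnP => // ml.
    by rewrite bin_small ?mulr0 ?mul0r.
  by rewrite ltnS leq_subr.
rewrite big_ord_recl bin0 !mul1r D0 opprD addrA subrr add0r -sumrN.
rewrite big_add1 /= big_mkord; apply: eq_bigr => l _.
by rewrite /bump /= add1n exprS; ring.
Qed.

(** The coefficient of (- z)^k / g k in the sum of the X l is a multiple of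
sum_binomial_differences: its part with weighted_ratio m gives gen_laguerre m,
and its part with weighted_ratio k, summed over k by sum_weighted_ratio, cancels
the only nonzero Y l, the one at l = 1. *)
Lemma gen_laguerre_recurrence m : (0 < m)%N -> (forall i, (i <= m)%N -> g i != 0) ->
  gen_laguerre m = \sum_(1 <= l < m.+1) (-1) ^+ l.-1 *
    (g m.-1 / g (m - l)%N *
       ((l`!%:R * m%:R)^-1 * binomial_transform (fun j => weighted_ratio (m - j)) l)
     - z / (m - l).+1%:R * (l == 1%N)%:R) * gen_laguerre (m - l).
Proof.
move=> m0 gn; have := @sum_binomial_differences m.
set D := binomial_transform _; move: D => D hD.
have mr : m%:R != 0 :> K by rewrite pnatr_eq0 -lt0n.
have mf i : i`!%:R != 0 :> K by rewrite pnatr_eq0 -lt0n fact_gt0.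
pose d k := (- z) ^+ k / g k.
pose X l := (-1) ^+ l.-1 * (g m.-1 / g (m - l)%N * ((l`!%:R * m%:R)^-1 * D l))
   * gen_laguerre (m - l).
pose Y l := (-1) ^+ l.-1 * (z / (m - l).+1%:R * (l == 1%N)%:R) * gen_laguerre (m - l).
rewrite (eq_bigr (fun l => X l - Y l)); last by move=> l _; rewrite /X /Y; ring.
rewrite sumrB.
have -> : \sum_(1 <= l < m.+1) Y l = z / m%:R * gen_laguerre m.-1.
  rewrite big_ltn // big_nat big1 ?addr0.
    by rewrite /Y eqxx mulr1 mul1r subn1 prednK.
  by move=> l /andP[l1 _]; rewrite /Y gtn_eqF // !mulr0 mul0r.
have hX l : (1 <= l < m.+1)%N -> X l = \sum_(k < m.+1)
     g m.-1 / (m`!%:R * m%:R) * 'C(m, k)%:R * d k *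
       ((-1) ^+ l.-1 * 'C(m - k, l)%:R * D l).
  move=> /andP[l0 lm]; rewrite /X (gen_laguerre_widen (leq_subr l m)).
  rewrite !mulr_sumr; apply: eq_bigr => k _.
  have gl : g (m - l)%N != 0 by apply: gn; exact: leq_subr.
  have hb : 'C(m - l, k)%:R = l`!%:R * (m - l)`!%:R * ('C(m, k)%:R * 'C(m - k, l)%:R) / m`!%:R :> K.
    by rewrite -!natrM -bin_fact_swap // natrM mulrC mulKf.
  rewrite hb -/(d k).
  have a1 := mf l; have a2 := mf m; have a3 := mf (m - l)%N.
  by field; rewrite mr gl a1 a2 a3.
rewrite (eq_big_nat _ _ hX) exchange_big /=.
under eq_bigr => k _ do rewrite -mulr_sumr hD -1?ltnS // mulrBr.
rewrite sumrB.
have -> : \sum_(k < m.+1) g m.-1 / (m`!%:R * m%:R) * 'C(m, k)%:R * d k * weighted_ratio k =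
   - (z / m%:R) * gen_laguerre m.-1.
  rewrite -sum_weighted_ratio // mulr_sumr; apply: eq_bigr => k _; rewrite -/(d k); ring.
rewrite mulNr opprK addrK /gen_laguerre mulr_sumr; apply: eq_bigr => k _.
have g1 : g m.-1 != 0 by apply: gn; exact: leq_pred.
have a2 := mf m.
by rewrite /weighted_ratio -/(d k); field; rewrite mr a2 g1.
Qed.
End Recurrence.

(** * Laguerre polynomials and their coefficients in terms of Gamma *)

Section LaguerreGamma.
Context {R : realType} (alpha beta z : R[i]).

Let g (k : nat) : R[i] := Gamma (alpha * k%:R + beta + 1).

Lemma rising_opp_nat (m k : nat) : (k <= m)%N ->
  rising (- m%:R : R[i]) k = (-1) ^+ k * ('C(m, k)%:R * k`!%:R).
Proof.
move=> km; rewrite -natrM bin_ffact ffact_prod natr_prod /rising.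
rewrite -[k in (-1) ^+ k]card_ord -prodrN.
apply: eq_bigr => i _; rewrite natrB ?opprB ?[- _ + _]addrC //.
by rewrite ltnW // (leq_trans (ltn_ord i)).
Qed.

Lemma laguerreE m : laguerre alpha beta m z = gen_laguerre g z m.
Proof.
rewrite /laguerre /gen_laguerre Gamma_nat -/(g m); congr (_ * _).
apply: eq_bigr => k _; rewrite -/(g k) rising_opp_nat -1?ltnS //.
have h : k`!%:R != 0 :> R[i] by rewrite pnatr_eq0 -lt0n fact_gt0.
rewrite [(- z) ^+ k]exprNn.
transitivity ((-1) ^+ k * 'C(m, k)%:R * z ^+ k * (g k)^-1 * (k`!%:R / k`!%:R)).
  by ring.
by rewrite divff // mulr1; ring.
Qed.

Lemma acoefE m l : (0 < l)%N -> (l <= m)%N ->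
  acoef alpha beta z (m - l) l =
    g m.-1 / g (m - l)%N *
       ((l`!%:R * m%:R)^-1 * binomial_transform (fun j => weighted_ratio g (m - j)) l)
     - z / (m - l).+1%:R * (l == 1%N)%:R.
Proof.
move=> l0 lm; rewrite /acoef /Bcoef subnKC //; congr (_ * _ - _).
  rewrite /falling /g; congr (Gamma _ / Gamma _).
    by rewrite -[in LHS](prednK (leq_trans l0 lm)) -natr1 addrK.
  by rewrite natrB //; ring.
rewrite /Ccoef; congr (_ * _); apply: eq_bigr => j _.
have jm : (j <= m)%N by rewrite (leq_trans _ lm) // -ltnS.
rewrite -mulrA; congr (_ * _); rewrite /weighted_ratio -natrB //.
(* For j = m the index of g (m - j - 1) is out of range, but the factor m - j
   vanishes. *)
have [->|mj] := posnP (m - j); first by rewrite !mul0r.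
congr (_ * _); rewrite /falling /g; congr (_ / Gamma _).
by rewrite -[in LHS](prednK mj) -natr1; ring.
Qed.

End LaguerreGamma.

Theorem theorem3 (R : realType) (alpha beta : R[i])
    (hbeta : -1 < complex.Re beta) (n : nat) (hn : (1 <= n)%N)
    (hpole : forall k m : nat, (k <= n)%N ->
       alpha * k%:R + beta + 1 <> - m%:R)
    (z : R[i]) :
  laguerre alpha beta n z =
  \sum_(1 <= k < n.+1)
    (-1) ^+ (n - k) *
    \sum_(t : {ffun 'I_k -> 'I_n.+1} | is_composition t)
      \prod_(i < k) acoef alpha beta z (partial_sum t i) (t i).
Proof.
pose g (k : nat) : R[i] := Gamma (alpha * k%:R + beta + 1).
have g0 k : (k <= n)%N -> g k != 0 
  by move=> kn; apply: Gamma_neq0 => m; exact: hpole.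
have u0 : laguerre alpha beta 0 z = 1.
  rewrite laguerreE /gen_laguerre big_ord1 bin0 expr0 fact0 divr1 !mul1r.
  by rewrite divff // g0.
have uS m : (0 < m)%N -> (m <= n)%N -> laguerre alpha beta m z =
    \sum_(1 <= l < m.+1) (-1) ^+ l.-1 * acoef alpha beta z (m - l) l *
       laguerre alpha beta (m - l) z.
  move=> m0 mn; rewrite laguerreE gen_laguerre_recurrence //; last first.
    by move=> i im; apply: g0; exact: leq_trans mn.
  apply: eq_big_nat => l /andP[l0 lm].
  by rewrite acoefE // laguerreE.
rewrite (recurrence_composition_weight u0 uS (leqnn n) (ltnSn n)).
have w0 : composition_weight (acoef alpha beta z) 0 n = 0.
  by rewrite /= eqn0Ngt hn.
rewrite big_ord_recl w0 mulr0 add0r big_add1 big_mkord [n.+1.-1]/=.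
apply: eq_bigr => k _; rewrite lift0 -(@sum_composition_weight _ _ n) //.
have kn : (k < n)%N by exact: ltn_ord.
have -> // : (-1) ^+ (n + k.+1) = (-1) ^+ (n - k.+1) :> R[i].
by rewrite -signr_odd oddD -oddB // signr_odd.
Qed.
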